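(* Let $d\ge 1$ and $n\ge 0$ be integers and let $N=\dim(\mathbb{P}_n)=\binom{n+d}{d}$. Let $\mu$ be a finite measure with support $\Omega\subseteq\mathbb{R}^d$ such that all polynomials in $\mathbb{P}_n$ are $\mu$-integrable, and let $\lambda$ be a finite measure with $\mathbb{P}_n$-determining support $B\subseteq\mathbb{R}^d$ such that all polynomials in $\mathbb{P}_{2n}$ are $\lambda$-integrable. Let $\{p_j\}_{1\le j\le N}$ be a $\lambda$-orthonormal basis of $\mathbb{P}_n$, and let $(X,\mathbf{u})=\{(x_i,u_i):1\le i\le M\}$, $M\ge N$, be the nodes $X=\{x_i\}\subseteq B$ and positive weights $u_i>0$ of a quadrature formula for $\lambda$ that is exact in $\mathbb{P}_{2n}$, i.e. $\int_B p(x)\,d\lambda=\sum_{i=1}^M u_i\,p(x_i)$ for all $p\in\mathbb{P}_{2n}$. Let $V=(v_{ij})\in\mathbb{R}^{M\times N}$ with $v_{ij}=p_j(x_i)$, let $D=\mathrm{diag}(u_1,\dots,u_M)$, let $\mathbf{m}=(m_j)\in\mathbb{R}^N$ with $m_j=\int_\Omega p_j(x)\,d\mu$, and let $\mathbf{w}=DV\mathbf{m}\in\mathbb{R}^M$. Assume moreover that $\Omega\subseteq B$. (i) If $B$ is bounded, then $$\|\mathbf{w}\|_1\le\sqrt{\lambda(B)}\;\mu(\Omega)\;\sqrt{\max_{x\in B}K_n(x,x)}\,,\qquad\text{where } K_n(x,x)=\sum_{j=1}^N p_j^2(x).$$ (ii) If $\mu$ and $\lambda$ are absolutely continuous with respect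 to the Lebesgue measure with densities $\omega\in L^1(\Omega)$ and $\sigma\in L^1(B)$, i.e. $d\mu=\omega(x)\,dx$ and $d\lambda=\sigma(x)\,dx$, and $\omega^2/\sigma\in L^1(\Omega)$, then $$\|\mathbf{w}\|_1\le\sqrt{\lambda(B)}\;\sqrt{\|\omega^2/\sigma\|_{L^1(\Omega)}}\,.$$
   Context: $\mathbb{P}_k$ denotes the space of real polynomials in $d$ variables of total degree at most $k$. Measures are (positive) Borel measures on $\mathbb{R}^d$; the support of a measure is its closed support. A set $B\subseteq\mathbb{R}^d$ is $\mathbb{P}_n$-determining if every polynomial in $\mathbb{P}_n$ vanishing on $B$ vanishes everywhere in $\mathbb{R}^d$. A basis $\{p_j\}$ of $\mathbb{P}_n$ is $\lambda$-orthonormal if $\int_B p_h p_k\,d\lambda=\delta_{hk}$ for all $h,k$. $\|\cdot\|_1$ is the $\ell^1$ norm of vectors. $L^1(\Omega)$ and $L^1(B)$ are taken with respect to the Lebesgue measure. In (ii), the quotient $\omega^2/\sigma$ is understood as $+\infty$ where $\sigma=0$ and $\omega\neq 0$, and as $0$ where $\sigma=\omega=0$; thus $\omega^2/\sigma\in L^1(\Omega)$ includes the requirement that $\omega=0$ a.e. on $\{x\in\Omega:\sigma(x)=0\}$. *)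

(* Defs.v *)
From HB Require Import structures.
From mathcomp Require Import all_boot all_order all_algebra.
(* mpoly must come first: its Measure and isMeasure would shadow the
   measure-theoretic ones. *)
From mathcomp Require Import -(notations) mpoly.
From mathcomp Require Import all_classical all_reals all_analysis.

Set Implicit Arguments.
Unset Strict Implicit.
Unset Printing Implicit Defensive.

Import Order.TTheory GRing.Theory Num.Theory.
Import numFieldNormedType.Exports.

Local Open Scope classical_set_scope.
Local Open Scope ring_scope.

Section borel.
Variables (R : realType) (d : nat).

Let opens : set (set 'rV[R]_d) := open.

HB.instance Definition _ := @isMeasurable.Build (sigma_display opens)
  'rV[R]_d <<s opens >> (@sigma_algebra0 _ setT opens)
  (@sigma_algebraC _ opens) (@sigma_algebra_bigcup _ setT opens).

End borel.

Lemma open_borel (R : realType) (d : nat) (U : set 'rV[R]_d) :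
  open U -> measurable U.
Proof. exact: sub_sigma_algebra. Qed.

(* d-dimensional Lebesgue measure, restricted to the Borel sets: the iterated
   product of the one-dimensional one, first built on d.-tuple R (which has the
   product sigma-algebra) and then transported to 'rV[R]_d. The lemma
   lebesgue_row_box below gives its value on boxes. *)
Section lebesgue_tuple.
Variable R : realType.
Local Notation R' := (measurableTypeR R).

Definition tcons n (p : R' * n.-tuple R') : n.+1.-tuple R' :=
  [tuple of p.1 :: p.2].

Lemma measurable_tcons n : measurable_fun setT (@tcons n).
Proof. exact: (measurable_cons measurable_fst measurable_snd). Qed.

Section cons_measure.
Variables (n : nat) (m : {sigma_finite_measure set (n.-tuple R') -> \bar R}).

Definition cons_measure : set (n.+1.-tuple R') -> \bar R :=
  pushforward (@lebesgue_measure R \x m)%E (@tcons n).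

HB.instance Definition _ := Measure.copy cons_measure
  (measure_function_pushforward__canonical__measure_function_Measure
    (@lebesgue_measure R \x m)%E (@measurable_tcons n)).

Let cons_sigma_finite : sigma_finite setT cons_measure.
Proof.
have /sigma_finiteP[F [TF ndF Foo]] := sigma_finiteT (@lebesgue_measure R).
have /sigma_finiteP[G [TG ndG Goo]] := sigma_finiteT m.
pose g (t : n.+1.-tuple R') : R' * n.-tuple R' := (thead t, [tuple of behead t]).
have mg : measurable_fun setT g.
  apply/measurable_fun_pairP; split; first exact: measurable_tnth.
  exact: measurable_behead.
have gK A : @tcons n @^-1` (g @^-1` A) = A.
  rewrite -comp_preimage (_ : g \o _ = id)//.
  by apply/funext => -[x t]; congr pair; apply/val_inj.
exists (fun k => g @^-1` (F k `*` G k)).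
  rewrite -preimage_bigcup [X in _ @^-1` X](_ : _ = setT) ?preimage_setT//.
  rewrite -setXTT TF TG; apply/seteqP; split => -[x y].
    by move=> [k _ []]; split; exists k.
  move=> [/= [k _ Fkx] [l _ Gly]]; exists (maxn k l) => //; split.
  - by move: x Fkx; exact/subsetPset/ndF/leq_maxl.
  - by move: y Gly; exact/subsetPset/ndG/leq_maxr.
move=> k; have [mFk Fk] := Foo k; have [mGk Gk] := Goo k; split.
  by rewrite -[X in measurable X]setTI; apply: mg => //; exact: measurableX.
rewrite /cons_measure /pushforward gK product_measure1E//.
by rewrite lte_mul_pinfty// ge0_fin_numE.
Qed.

HB.instance Definition _ := Measure_isSigmaFinite.Build _ _ _ cons_measure
  cons_sigma_finite.

End cons_measure.

Fixpoint lebesgue_tuple n : {sigma_finite_measure set (n.-tuple R') -> \bar R} :=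
  if n is k.+1 then cons_measure (lebesgue_tuple k) else \d_[tuple].

Lemma lebesgue_tuple_box n (A : 'I_n -> set R') :
  (forall i, measurable (A i)) ->
  lebesgue_tuple n [set t | forall i, A i (tnth t i)] =
    (\prod_(i < n) lebesgue_measure (A i))%E.
Proof.
elim: n A => [|n IH] A mA.
  rewrite big_ord0 /= /dirac indicE mem_set//.
  by move=> [].
rewrite big_ord_recl /= /cons_measure /pushforward.
rewrite -(IH (fun i => A (lift ord0 i)))//.
have mB : measurable [set t : n.-tuple R' | forall i, A (lift ord0 i) (tnth t i)].
  rewrite (_ : mkset _ =
    \bigcap_(i in [set: 'I_n]) ((@tnth n R')^~ i @^-1` A (lift ord0 i))).
    apply: fin_bigcap_measurable => // i _.
    by rewrite -[X in measurable X]setTI; exact: measurable_tnth.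
  by apply/seteqP; split => t /= h i; [move=> _; exact: h|exact: h].
rewrite -product_measure1E//; congr (_ _).
apply/seteqP; split => -[x t] /=.
  move=> h; split; first exact: (h ord0).
  by move=> i; have := h (lift ord0 i); rewrite /tcons tnthS.
move=> [Ax At] i; case: (unliftP ord0 i) => [j ->|->//].
by rewrite /tcons tnthS.
Qed.

End lebesgue_tuple.

Section lebesgue_row.
Variables (R : realType) (d : nat).
Local Notation R' := (measurableTypeR R).

Definition row_of_tuple (t : d.-tuple R') : 'rV[R]_d := \row_i tnth t i.

Lemma measurable_row_of_tuple : measurable_fun setT row_of_tuple.
Proof.
apply: (@measurability _ _ _ _ setT row_of_tuple open) => // _ [U oU <-]; rewrite setTI.
pose idx := ('rV[rat]_d * nat)%type.
pose c (q : 'rV[rat]_d) : 'rV[R]_d := map_mx ratr q.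
pose box (i : idx) : set 'rV[R]_d := [set x | forall j, `|c i.1 0 j - x 0 j| < i.2.+1%:R^-1].
pose F (i : idx) := if `[< box i `<=` U >] then row_of_tuple @^-1` box i else set0.
have -> : row_of_tuple @^-1` U = \bigcup_i F i.
  apply/seteqP; split=> [t Ut|t [i _]]; last first.
    rewrite /F; case: ifPn => // /asboolP boxU; exact: boxU.
  have /nbhs_ballP[e /= e0 eU] : nbhs (row_of_tuple t) U by exact: open_nbhs_nbhs.
  have [n ne] : exists n, n.+1%:R^-1 < e / 2.
    have [n _ h] := near_infty_natSinv_lt (PosNum (divr_gt0 e0 (ltr0Sn R 1))).
    by exists n; exact: (h n (leqnn n)).
  have n0 : 0 < n.+1%:R^-1 :> R by rewrite invr_gt0.
  have /choice[q qP] : forall j, exists q : rat, `|ratr q - tnth t j| < n.+1%:R^-1 :> R.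
    move=> j; have [|q] := @rat_in_itvoo R (tnth t j - n.+1%:R^-1) (tnth t j + n.+1%:R^-1).
      by rewrite ltrBlDr -addrA ltrDl addr_gt0.
    by rewrite in_itv /= => qj; exists q; rewrite ltr_distl.
  exists (\row_j q j, n) => //; rewrite /F; case: ifPn => [_ j|/asboolP[]].
    by rewrite !mxE.
  move=> x bx; apply: eU; split => // i j; rewrite ord1 mxE.
  rewrite /ball /= (splitr e).
  apply: le_lt_trans (ler_distD (ratr (q j)) _ _) _.
  rewrite ltrD//; first by rewrite distrC (lt_trans (qP j)).
  by have := bx j; rewrite !mxE => /lt_trans; apply.
apply: countable_bigcupT_measurable; first exact: countableP.
move=> i; rewrite /F; case: ifPn => // _.
have -> : row_of_tuple @^-1` box i =
    \bigcap_(j in [set: 'I_d]) ((fun t => tnth t j) @^-1` ball (c i.1 0 j) (i.2.+1%:R^-1)).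
  apply/seteqP; split => t /= h.
    by move=> j _; have := h j; rewrite !mxE.
  by move=> j; have := h j I; rewrite /ball /= !mxE.
apply: fin_bigcap_measurable => // j _.
rewrite -[X in measurable X]setTI; apply: measurable_tnth => //.
by rewrite ball_itv; exact: measurable_itv.
Qed.

Definition lebesgue_row : set 'rV[R]_d -> \bar R :=
  pushforward (lebesgue_tuple R d) row_of_tuple.

HB.instance Definition _ := Measure.copy lebesgue_row
  (measure_function_pushforward__canonical__measure_function_Measure
    (lebesgue_tuple R d) measurable_row_of_tuple).

Lemma lebesgue_row_box (A : 'I_d -> set R') : (forall i, measurable (A i)) ->
  lebesgue_row [set x | forall i, A i (x ord0 i)] =
    (\prod_(i < d) lebesgue_measure (A i))%E.
Proof.
move=> mA; rewrite -lebesgue_tuple_box// /lebesgue_row /pushforward.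
congr (_ _); apply/seteqP; split => t /= h i; first by have := h i; rewrite mxE.
by rewrite mxE.
Qed.

End lebesgue_row.

Arguments lebesgue_row R d : clear implicits.

Section definitions.
Variables (R : realType) (d : nat).
Local Notation poly := (mpoly d R).
Local Notation Rd := 'rV[R]_d.

Definition peval (p : poly) (x : Rd) : R := meval (x ord0) p.

(* msize is the total degree plus one, and 0 for the zero polynomial. *)
Definition poly_le (k : nat) : set poly := [set p | (msize p <= k.+1)%N].

Definition poly_basis (k N : nat) (p : 'I_N -> poly) : Prop :=
  [/\ forall j, poly_le k (p j),
      forall c : 'I_N -> R, \sum_(j < N) c j *: p j = 0 -> forall j, c j = 0
    & forall q, poly_le k q ->
        exists c : 'I_N -> R, q = \sum_(j < N) c j *: p j].

Definition measure_support (mu : set Rd -> \bar R) : set Rd :=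
  [set x | forall U, open U -> U x -> (0 < mu U)%E].

Definition poly_determining (k : nat) (B : set Rd) : Prop :=
  forall p, poly_le k p -> (forall x, B x -> peval p x = 0) ->
    forall x, peval p x = 0.

Definition poly_integrable (k : nat) (mu : set Rd -> \bar R) : Prop :=
  forall p, poly_le k p -> mu.-integrable setT (EFin \o peval p).

Definition poly_orthonormal (lambda : {measure set Rd -> \bar R}) (B : set Rd)
    (N : nat) (p : 'I_N -> poly) : Prop :=
  forall h k, \int[lambda]_(x in B) (peval (p h) x * peval (p k) x) = (h == k)%:R.

Definition quadrature_exact (k : nat) (lambda : {measure set Rd -> \bar R})
    (B : set Rd) (M : nat) (x : 'I_M -> Rd) (u : 'I_M -> R) : Prop :=
  forall p, poly_le k p ->
    \int[lambda]_(y in B) peval p y = \sum_(i < M) u i * peval p (x i).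

(* K_n(x,x) for the orthonormal basis p of P_n. *)
Definition kernel_diag (N : nat) (p : 'I_N -> poly) (x : Rd) : R :=
  \sum_(j < N) peval (p j) x ^+ 2.

Definition is_max_on (B : set Rd) (f : Rd -> R) (m : R) : Prop :=
  (exists2 x, B x & f x = m) /\ (forall x, B x -> f x <= m).

Definition l1norm (M : nat) (v : 'cV[R]_M) : R := \sum_(i < M) `|v i ord0|.

(* f in L^1(A) and d mu = f(x) dx, where f is extended by 0 outside A. *)
Definition has_lebesgue_density (mu : set Rd -> \bar R) (A : set Rd)
    (f : Rd -> R) : Prop :=
  (lebesgue_row R d).-integrable A (EFin \o f) /\
  forall E, measurable E ->
    mu E = (\int[lebesgue_row R d]_(x in E `&` A) (f x)%:E)%E.

Definition sqr_quotient (omega sigma : Rd -> R) (x : Rd) : \bar R :=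
  if sigma x == 0 then (if omega x == 0 then 0%E else +oo%E)
  else (omega x ^+ 2 / sigma x)%:E.

Definition lebesgue_L1norm (A : set Rd) (f : Rd -> \bar R) : \bar R :=
  (\int[lebesgue_row R d]_(x in A) `|f x|)%E.

End definitions.

(* Main.v *)
(* Let q = sum_j m_j p_j, so that w_i = u_i q(x_i). Cauchy-Schwarz with the
   weights u_i gives |w|_1 <= sqrt (sum_i u_i) sqrt (sum_i u_i q(x_i)^2), and
   exactness of the quadrature for 1 and q^2 turns the right-hand side into
   sqrt (lambda B) sqrt S with S = int_B q^2 dlambda = sum_j m_j^2. By linearity
   S is also int_Omega q dmu. In (i), |q(x)| <= sqrt S sqrt K_n(x,x) then yields
   S <= mu(Omega) sqrt S sqrt (max K_n). In (ii), integrating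
   2 |q| |omega| <= q^2 |sigma| + omega^2 / |sigma| yields
   2 S <= S + |omega^2 / sigma|_1. *)
Require Import Defs.
From HB Require Import structures.
From mathcomp Require Import all_boot all_order all_algebra.
From mathcomp Require Import -(notations) mpoly.
From mathcomp Require Import all_classical all_reals all_analysis.
From mathcomp Require Import measurable_realfun ring lra.
Set Implicit Arguments.
Unset Strict Implicit.
Unset Printing Implicit Defensive.
Import Order.TTheory GRing.Theory Num.Theory.
Import numFieldNormedType.Exports.
Local Open Scope classical_set_scope.
Local Open Scope ring_scope.

(** * Cauchy-Schwarz inequalities for finite sums *)

Lemma sqr_sum_mul_le (R : realDomainType) (I : finType) (a b : I -> R) :
  (\sum_i a i * b i) ^+ 2 <= (\sum_i a i ^+ 2) * (\sum_i b i ^+ 2).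
Proof.
(* Lagrange's identity: this double sum is twice the right-hand side minus twice the left-hand
   side. *)
have : 0 <= \sum_i \sum_j (a i * b j - a j * b i) ^+ 2.
  by apply: sumr_ge0 => i _; apply: sumr_ge0 => j _; exact: sqr_ge0.
have E (i j : I) : (a i * b j - a j * b i) ^+ 2 = a i ^+ 2 * b j ^+ 2
    + b i ^+ 2 * a j ^+ 2 - 2 * (a i * b i) * (a j * b j) by ring.
under eq_bigr => i _ do under eq_bigr => j _ do rewrite E.
under eq_bigr => i _ do rewrite sumrB big_split /= -!mulr_sumr.
rewrite sumrB big_split /= -!mulr_suml -mulr_sumr.
set A := \sum_i a i ^+ 2; set B := \sum_i b i ^+ 2.
by rewrite (mulrC B) expr2 => h; lra.
Qed.

Lemma sum_mul_le_sqrt (R : rcfType) (I : finType) (a b : I -> R) :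
  \sum_i a i * b i <=
    Num.sqrt (\sum_i a i ^+ 2) * Num.sqrt (\sum_i b i ^+ 2).
Proof.
rewrite -sqrtrM ?sumr_ge0 // => [|i _]; last exact: sqr_ge0.
apply: le_trans (ler_norm _) _.
by rewrite -sqrtr_sqr ler_wsqrtr // sqr_sum_mul_le.
Qed.

(** Cauchy-Schwarz for the factors [Num.sqrt (u i)] and [Num.sqrt (u i) * |a i|]. *)
Lemma weighted_sum_norm_le (R : rcfType) (I : finType) (u a : I -> R) :
  (forall i, 0 <= u i) ->
  \sum_i u i * `|a i| <=
    Num.sqrt (\sum_i u i) * Num.sqrt (\sum_i u i * a i ^+ 2).
Proof.
move=> u0.
have := @sum_mul_le_sqrt _ _ (fun i => Num.sqrt (u i))
  (fun i => Num.sqrt (u i) * `|a i|).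
under eq_bigr do rewrite mulrA -expr2 sqr_sqrtr //.
under [in X in _ <= X * _]eq_bigr do rewrite sqr_sqrtr //.
by under [in X in _ <= _ * X]eq_bigr do
  rewrite exprMn sqr_sqrtr // real_normK ?num_real //.
Qed.

(** * Integration against a measure given by a density *)

Section density.
Context (disp : measure_display) (T : measurableType disp) (R : realType).
Variables (mu nu : {measure set T -> \bar R}) (D : set T).
Hypothesis mD : measurable D.
Local Open Scope ereal_scope.

(* The density is nonnegative almost everywhere because [mu] is; replacing it by
   its absolute value makes it nonnegative everywhere. *)
Lemma density_abs (g : T -> R) : nu.-integrable D (EFin \o g) ->
  (forall E, measurable E -> mu E = \int[nu]_(x in E `&` D) (g x)%:E) ->
  forall E, measurable E -> mu E = \int[nu]_(x in E `&` D) `|g x|%:E.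
Proof.
move=> gi muE E mE.
have mg : measurable_fun D g by apply/measurable_EFinP; exact: measurable_int gi.
pose N := D `&` [set x | (g x < 0)%R].
have mN : measurable N.
  rewrite (_ : N = D `&` g @^-1` `]-oo, 0%R[).
    by apply: mg => //; exact: measurable_itv.
  by apply/seteqP; split => x [Dx] /= h; split => //; move: h; rewrite in_itv.
have ND : N `&` D = N by apply/setIidPl => x [].
have mgS A : measurable A -> A `<=` D -> measurable_fun A (fun x => `|g x|%:E).
  move=> mA AD; apply/measurable_EFinP; apply: measurableT_comp => //.
  exact: measurable_funS mg.
have muN := muE _ mN; rewrite ND in muN.
(* On [N] the absolute value is [- g], so a nonnegative integral equals [- mu N], which is
   nonpositive. Hence both vanish. *)
have intN : \int[nu]_(x in N) `|g x|%:E = - mu N.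
  rewrite muN -integralN.
    by apply: eq_integral => x; rewrite inE => -[_ /= g0] /=; rewrite ltr0_norm.
  apply: integrable_add_def => //; apply: (integrableS mD mN _ gi).
  exact: subIsetl.
have intN0 : \int[nu]_(x in N) `|g x|%:E = 0.
  apply/eqP; rewrite eq_le integral_ge0 // andbT.
  by rewrite intN leeNl oppe0 measure_ge0.
have muN0 : mu N = 0 by apply/eqP; rewrite -oppe_eq0 -intN intN0.
have disj A : [disjoint A `\` N & A `&` N].
  by apply/disj_setPS => x [] [_ nN] [_].
have mED : measurable (E `&` D) by exact: measurableI.
have ENDE : (E `\` N) `&` D = (E `&` D) `\` N by rewrite setIC setIDA (setIC D).
(* Both sides are split along [N]. The part inside [N] contributes nothing to either of them, and
   outside [N] the functions [g] and [|g|] agree. *)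
rewrite (measureDI mu mE mN).
rewrite [X in _ + X](_ : _ = 0); last first.
  apply/eqP; rewrite eq_le measure_ge0 andbT -muN0.
  by apply: le_measure; rewrite ?inE //; exact: measurableI.
rewrite adde0 [LHS]muE; last exact: measurableD.
rewrite ENDE.
have -> : \int[nu]_(x in E `&` D) `|g x|%:E =
    \int[nu]_(x in (E `&` D) `\` N) `|g x|%:E +
    \int[nu]_(x in (E `&` D) `&` N) `|g x|%:E.
  rewrite -ge0_integral_setU //; first by rewrite setUC setUIDK.
  - exact: measurableD.
  - exact: measurableI.
  - by rewrite setUC setUIDK; apply: mgS.
rewrite [X in _ = _ + X](_ : _ = 0); last first.
  apply/eqP; rewrite eq_le integral_ge0 // andbT -intN0.
  apply: ge0_subset_integral => //; first exact: measurableI.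
  by apply: mgS => // x [].
rewrite adde0; apply: eq_integral => x; rewrite inE => -[[Ex Dx] nN].
by rewrite ger0_norm // leNgt; apply/negP => g0; apply: nN; split.
Qed.

Import HBNNSimple.

(** Monotone convergence reduces the claim to simple functions, and linearity reduces it further to
    indicators of level sets, where it is the hypothesis on [mu]. *)
Lemma ge0_integral_density (g : T -> R) :
  measurable_fun D g -> (forall x, 0 <= g x)%R ->
  (forall E, measurable E -> mu E = \int[nu]_(x in E `&` D) (g x)%:E) ->
  forall f : T -> \bar R, measurable_fun D f -> (forall x, 0 <= f x) ->
  \int[mu]_(x in D) f x = \int[nu]_(x in D) (f x * (g x)%:E).
Proof.
move=> mg g0 muE f mf f0.
have mgE : measurable_fun D (EFin \o g) by exact/measurable_EFinP.
pose h := nnsfun_approx mD mf.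
have hD n : measurable_fun D (EFin \o h n).
  by apply/measurable_EFinP; exact: measurable_funTS.
have hle x : {homo (fun n => h n x) : a b / (a <= b)%N >-> (a <= b)%R}.
  by move=> a b ab; exact/lefP/nd_nnsfun_approx.
transitivity (limn (fun n => \int[mu]_(x in D) (h n x)%:E)).
  rewrite -monotone_convergence //.
  - apply: eq_integral => x /[!inE] Dx; apply/esym/cvg_lim => //.
    exact: cvg_nnsfun_approx.
  - by move=> n x _; rewrite lee_fin.
  - by move=> x _ a b ab; rewrite lee_fin; exact: hle.
transitivity (limn (fun n => \int[nu]_(x in D) ((h n x)%:E * (g x)%:E))); last first.
  rewrite -monotone_convergence //.
  - apply: eq_integral => x /[!inE] Dx; apply/cvg_lim => //.
    by apply: cvgeZr => //; exact: cvg_nnsfun_approx.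
  - by move=> n; apply: emeasurable_funM => //; exact: hD.
  - by move=> n x _; rewrite mule_ge0 // lee_fin.
  - by move=> x _ a b ab; rewrite lee_wpmul2r ?lee_fin //; exact: hle.
(* The two limits are compared term by term: from here on [h n] is a fixed simple function, written
   as the finite sum over its values [y] of [y] times the indicator of the level set. *)
apply: congr_lim; apply/funext => n.
have m1 r : measurable_fun D (fun x => (r * \1_(h n @^-1` [set r]) x)%:E).
  by apply/measurable_EFinP/measurable_funTS; exact: measurable_funM.
transitivity (\int[mu]_(x in D)
   (\sum_(y \in range (h n)) (y * \1_(h n @^-1` [set y]) x)%:E)).
  by apply: eq_integral => x _; rewrite fimfunE -fsumEFin.
rewrite ge0_integral_fsum //; last by move=> y x _; exact: nnfun_muleindic_ge0.
transitivity (\int[nu]_(x in D) (\sum_(y \in range (h n))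
    ((y * \1_(h n @^-1` [set y]) x)%:E * (g x)%:E))); last first.
  apply: eq_integral => x _.
  rewrite -ge0_mule_fsuml => [|y]; last exact: nnfun_muleindic_ge0.
  by rewrite fsumEFin // -(fimfunE _ x).
rewrite ge0_integral_fsum //; last 2 first.
- by move=> y; exact: emeasurable_funM.
- by move=> y x _; apply: mule_ge0; [exact: nnfun_muleindic_ge0|
    rewrite lee_fin].
apply: eq_fsbigr => _ /[!inE] -[x0 _ <-]; set r := h n x0.
pose A := h n @^-1` [set r].
have mA : measurable A by exact: measurable_sfunP.
rewrite integralZl_indic_nnsfun // integral_indic // muE; last exact: measurableI.
under [RHS]eq_integral do rewrite EFinM -muleA.
rewrite ge0_integralZl //; last 3 first.
- apply: emeasurable_funM => //; apply/measurable_EFinP/measurable_funTS.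
  exact: measurable_indic.
- by move=> x _; rewrite mule_ge0 ?lee_fin.
- by rewrite lee_fin.
(* Applying [muE] to the intersection of [A] and [D] intersects with [D] a second time. This is
   collapsed, and the restriction to [A] becomes the indicator factor. *)
congr (_ * _); rewrite -setIA setIid setIC integral_mkcondr.
apply: eq_integral => x _; rewrite patchE indicE.
by case: ifPn; rewrite ?mul1e ?mul0e.
Qed.
End density.

(** * Continuity of polynomials and Borel measurability of supports *)

Lemma continuous_peval (R : realType) d (p : mpoly d R) : continuous (peval p).
Proof.
rewrite (_ : peval p = fun x =>
    \sum_(m <- msupp p) mcoeff m p * \prod_i x ord0 i ^+ m i); last first.
  by apply/funext => x; rewrite /peval mevalE.
apply: (@continuous_big R^o) => [|m _]; first exact: add_continuous.
move=> x; apply: continuousM; first exact: cst_continuous.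
apply: (@continuous_big R^o _ *%R 1 predT (@mul_continuous R)) => i _ y.
apply: (@continuous_comp _ _ _ (fun z : 'rV[R]_d => z ord0 i) (fun t => t ^+ m i)).
  exact: coord_continuous.
exact: exprn_continuous.
Qed.

(** The complement of the support is the union of the open sets whose measure is not positive. *)
Lemma closed_measure_support (R : realType) d (mu : set 'rV[R]_d -> \bar R) :
  closed (measure_support mu).
Proof.
rewrite -openC (_ : ~` _ = \bigcup_(U in [set U | open U /\ ~ (0 < mu U)%E]) U).
  by apply: bigcup_open => U [].
apply/seteqP; split=> [x /existsNP[U] /not_implyP[oU] /not_implyP[Ux muU]|].
  by exists U.
by move=> x [U [oU muU] Ux] /(_ U oU Ux).
Qed.

Lemma measurable_measure_support (R : realType) d
  (mu : set 'rV[R]_d -> \bar R) : measurable (measure_support mu).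
Proof.
rewrite -[measure_support mu]setCK; apply: measurableC; apply: open_borel.
by apply: closed_openC; exact: closed_measure_support.
Qed.

(** * Degree bounds and evaluation of polynomials *)

Section polynomials.
Variables (R : realType) (d : nat).
Implicit Types p q : mpoly d R.

Lemma poly_le1 k : poly_le k (1 : mpoly d R).
Proof. by rewrite /poly_le /= msize1. Qed.

Lemma poly_leM k l p q : poly_le k p -> poly_le l q -> poly_le (k + l) (p * q).
Proof.
rewrite /poly_le /= => pk ql.
(* Sizes are degrees plus one, so the size of a product is the sum of the sizes minus one. This
   fails for a zero factor, whose size is 0. *)
have [->|p0] := eqVneq p 0; first by rewrite mul0r mmeasure0.
have [->|q0] := eqVneq q 0; first by rewrite mulr0 mmeasure0.
by rewrite msizeM // -subn1 leq_subLR (leq_trans (leq_add pk ql)) // addSn addnS.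
Qed.

Lemma poly_le_lincomb k N (c : 'I_N -> R) (p : 'I_N -> mpoly d R) :
  (forall j, poly_le k (p j)) -> poly_le k (\sum_j c j *: p j).
Proof.
move=> pk; rewrite /poly_le /=; apply: leq_trans (msize_sum _ _ _) _.
by apply/bigmax_leqP => j _; exact: leq_trans (msizeZ_le _ _) (pk j).
Qed.

Lemma peval_lincomb N (c : 'I_N -> R) (p : 'I_N -> mpoly d R) x :
  peval (\sum_j c j *: p j) x = \sum_j c j * peval (p j) x.
Proof. by rewrite /peval raddf_sum; apply: eq_bigr => j _; exact: mevalZ. Qed.

Lemma peval1 x : peval (1 : mpoly d R) x = 1.
Proof. exact: mevalC. Qed.

Lemma pevalM p q x : peval (p * q) x = peval p x * peval q x.
Proof. exact: mevalM. Qed.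

End polynomials.

(** * Consequences of the exactness of the quadrature formula *)

Section quadrature.
Variables (R : realType) (d n M N : nat).
Variables (lambda : {measure set 'rV[R]_d -> \bar R}) (B : set 'rV[R]_d).
Variables (x : 'I_M -> 'rV[R]_d) (u : 'I_M -> R).
Hypotheses (mB : measurable B) (u0 : forall i, 0 < u i)
  (exact_x : quadrature_exact (2 * n) lambda B x u).

Lemma Rintegral_sqr_quadrature (q : mpoly d R) : poly_le n q ->
  \int[lambda]_(y in B) (peval q y ^+ 2) = \sum_i u i * peval q (x i) ^+ 2.
Proof.
move=> qn; have /exact_x : poly_le (2 * n) (q * q).
  by rewrite mul2n -addnn; exact: poly_leM.
under eq_Rintegral do rewrite pevalM -expr2.
by under [RHS]eq_bigr do rewrite pevalM -expr2.
Qed.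

Lemma quadrature_l1_le (q : mpoly d R) : poly_le n q ->
  \sum_i u i * `|peval q (x i)| <=
    Num.sqrt (fine (lambda B)) *
    Num.sqrt (\int[lambda]_(y in B) (peval q y ^+ 2)).
Proof.
move=> qn; rewrite Rintegral_sqr_quadrature //.
(* Exactness for the constant 1 gives the total weight. *)
have -> : fine (lambda B) = \sum_i u i.
  have /exact_x : poly_le (2 * n) (1 : mpoly d R).
    exact: poly_le1.
  under eq_Rintegral do rewrite peval1.
  by under [RHS]eq_bigr do rewrite peval1 mulr1; rewrite Rintegral_cst // mul1r => ->.
by apply: weighted_sum_norm_le => i; exact: ltW.
Qed.

(** Parseval's identity, proved at the nodes: products of two basis elements have degree at most
    [2 * n], so the discrete Gram matrix is the identity too, and the square is expanded in finite
    sums instead of under the integral. *)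
Lemma Rintegral_sqr_orthonormal (p : 'I_N -> mpoly d R) (c : 'I_N -> R) :
  (forall j, poly_le n (p j)) -> poly_orthonormal lambda B p ->
  \int[lambda]_(y in B) (peval (\sum_j c j *: p j) y ^+ 2) = \sum_j c j ^+ 2.
Proof.
move=> pn orth; rewrite Rintegral_sqr_quadrature; last exact: poly_le_lincomb.
have gram h k : \sum_i u i * (peval (p h) (x i) * peval (p k) (x i)) = (h == k)%:R.
  rewrite -orth; have /exact_x : poly_le (2 * n) (p h * p k).
    by rewrite mul2n -addnn; exact: poly_leM.
  under eq_Rintegral do rewrite pevalM.
  by move=> ->; apply: eq_bigr => i _; rewrite pevalM.
transitivity (\sum_h \sum_k c h * c k *
    \sum_i u i * (peval (p h) (x i) * peval (p k) (x i))).
  under [RHS]eq_bigr do under eq_bigr do rewrite mulr_sumr.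
  under [RHS]eq_bigr do rewrite exchange_big /=.
  rewrite exchange_big /=; apply: eq_bigr => i _.
  rewrite peval_lincomb expr2 mulr_suml mulr_sumr; apply: eq_bigr => h _.
  rewrite mulr_sumr mulr_sumr; apply: eq_bigr => k _; ring.
apply: eq_bigr => h _; rewrite (bigD1 h) //= gram eqxx mulr1 -expr2 big1 ?addr0 //.
by move=> k kh; rewrite gram eq_sym (negbTE kh) mulr0.
Qed.

End quadrature.

(** * Linear combinations of the basis: pointwise bound and integral *)

Lemma peval_le_kernel (R : realType) d N (p : 'I_N -> mpoly d R)
    (c : 'I_N -> R) y :
  `|peval (\sum_j c j *: p j) y| <=
    Num.sqrt (\sum_j c j ^+ 2) * Num.sqrt (kernel_diag p y).
Proof.
rewrite peval_lincomb -sqrtr_sqr -sqrtrM ?sumr_ge0 // => [|i _]; last exact: sqr_ge0.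
by rewrite ler_wsqrtr // sqr_sum_mul_le.
Qed.

Lemma Rintegral_peval_lincomb (R : realType) d n N
    (mu : {measure set 'rV[R]_d -> \bar R}) (D : set 'rV[R]_d)
    (p : 'I_N -> mpoly d R) (c : 'I_N -> R) :
  measurable D -> poly_integrable n mu -> (forall j, poly_le n (p j)) ->
  \int[mu]_(y in D) peval (\sum_j c j *: p j) y =
    \sum_j c j * \int[mu]_(y in D) peval (p j) y.
Proof.
move=> mD muint pn.
have pint q : poly_le n q -> mu.-integrable D (EFin \o peval q).
  by move=> qn; apply: integrableS (muint _ qn).
rewrite /Rintegral.
under eq_integral => y _ do
  (rewrite peval_lincomb -sumEFin; under eq_bigr do rewrite EFinM).
rewrite integral_sum //; last by move=> j; apply: integrableZl => //; exact: pint.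
(* Integrability makes every term finite, so that [fine] commutes with the sum and with the
   products. *)
rewrite -sum_fine => [|j _].
  apply: eq_bigr => j _; rewrite integralZl //; last exact: pint.
  by rewrite fineM //; apply: integrable_fin_num => //; exact: pint.
apply: integrable_fin_num => //; apply: integrableZl => //; exact: pint.
Qed.


(** * Comparison of two measures with Lebesgue densities *)

Lemma mul_norm_le_sqr_quotient (R : realType) d (omega sigma : 'rV[R]_d -> R)
    (t : R) y :
  ((t * `|omega y|)%:E + (t * `|omega y|)%:E <=
    (t ^+ 2)%:E * `|sigma y|%:E + `|sqr_quotient omega sigma y|)%E.
Proof.
(* Where [sigma] vanishes, either [omega] vanishes as well and both sides are 0, or the quotient is
   [+oo] and so is the right-hand side. *)
rewrite /sqr_quotient; have [s0|s0] := eqVneq (sigma y) 0.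
  have [w0|w0] := eqVneq (omega y) 0.
    by rewrite s0 w0 !normr0 !mulr0 !mule0 !add0e abse0.
  by rewrite -EFinM /= addey // leey.
rewrite -EFinM -EFinD /= -EFinD lee_fin normrM normfV normrX.
set s := `|sigma y|; set w := `|omega y|.
have sgt0 : 0 < s by rewrite normr_gt0.
(* The arithmetic-geometric mean inequality, as a completed square divided by [s]. *)
rewrite -subr_ge0 (_ : _ - _ = (t * s - w) ^+ 2 / s); last by field; rewrite gt_eqF.
by rewrite divr_ge0 ?sqr_ge0 // ltW.
Qed.

(** [has_lebesgue_density] does not ask for a nonnegative density; [density_abs] allows [omega] to
    be replaced by its absolute value. *)
Lemma ge0_integral_lebesgue_density (R : realType) d
    (mu : {measure set 'rV[R]_d -> \bar R}) (D : set 'rV[R]_d)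
    (omega : 'rV[R]_d -> R) (f : 'rV[R]_d -> \bar R) :
  measurable D -> has_lebesgue_density mu D omega ->
  measurable_fun D f -> (forall y, 0 <= f y)%E ->
  (\int[mu]_(y in D) f y = \int[lebesgue_row R d]_(y in D) (f y * `|omega y|%:E))%E.
Proof.
move=> mD [iw muE] mf f0.
have mw : measurable_fun D omega by apply/measurable_EFinP; exact: measurable_int iw.
apply: (ge0_integral_density mD _ _ (density_abs mD iw muE)) => //.
exact: measurableT_comp.
Qed.

(** The pointwise inequality with [t] equal to [|f y|] is integrated over [Omega]; the term with
    [sigma] is then enlarged from [Omega] to [B]. All integrands are nonnegative, so the argument
    runs in the extended reals without finiteness conditions. *)
Lemma integral_density_le (R : realType) d
    (mu lambda : {measure set 'rV[R]_d -> \bar R}) (Omega B : set 'rV[R]_d)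
    (omega sigma f : 'rV[R]_d -> R) :
  measurable Omega -> measurable B -> Omega `<=` B -> measurable_fun setT f ->
  has_lebesgue_density mu Omega omega ->
  has_lebesgue_density lambda B sigma ->
  measurable_fun Omega (sqr_quotient omega sigma) ->
  (\int[mu]_(y in Omega) `|f y|%:E + \int[mu]_(y in Omega) `|f y|%:E <=
    \int[lambda]_(y in B) (f y ^+ 2)%:E +
    lebesgue_L1norm Omega (sqr_quotient omega sigma))%E.
Proof.
move=> mO mB OB mf dw ds mq.
have mw : measurable_fun Omega omega.
  by apply/measurable_EFinP; exact: measurable_int dw.1.
have msB : measurable_fun B sigma.
  by apply/measurable_EFinP; exact: measurable_int ds.1.
have mabs D : measurable_fun D (fun y => `|f y|%:E).
  by apply/measurable_EFinP/measurableT_comp => //; exact: measurable_funTS.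
have msqr D : measurable_fun D (fun y => (f y ^+ 2)%:E).
  by apply/measurable_EFinP; apply: measurable_funX; exact: measurable_funTS.
rewrite (ge0_integral_lebesgue_density mO dw) //.
rewrite (ge0_integral_lebesgue_density mB ds) //; last first.
  by move=> y; rewrite lee_fin sqr_ge0.
have mfw : measurable_fun Omega (fun y => (`|f y|%:E * `|omega y|%:E)%E).
  by apply: emeasurable_funM => //; apply/measurable_EFinP/measurableT_comp.
have mfsB : measurable_fun B (fun y => ((f y ^+ 2)%:E * `|sigma y|%:E)%E).
  by apply: emeasurable_funM => //; apply/measurable_EFinP/measurableT_comp.
have mfs : measurable_fun Omega (fun y => ((f y ^+ 2)%:E * `|sigma y|%:E)%E).
  exact: measurable_funS mfsB.
have fs0 y : (0 <= (f y ^+ 2)%:E * `|sigma y|%:E)%E.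
  by rewrite mule_ge0 // lee_fin ?sqr_ge0.
have mqabs : measurable_fun Omega (fun y => `|sqr_quotient omega sigma y|)%E.
  exact: measurableT_comp.
rewrite -ge0_integralD //.
apply: (@le_trans _ _ (\int[lebesgue_row R d]_(y in Omega)
    ((f y ^+ 2)%:E * `|sigma y|%:E + `|sqr_quotient omega sigma y|))%E).
  apply: ge0_le_integral => //.
  - by move=> y _; rewrite adde_ge0.
  - exact: emeasurable_funD.
  - exact: emeasurable_funD.
  - move=> y _; rewrite -EFinM -[f y ^+ 2]real_normK ?num_real //.
    exact: mul_norm_le_sqr_quotient.
rewrite ge0_integralD // leeD2r //.
exact: ge0_subset_integral.
Qed.

Theorem corollary2p1 (R : realType) (d n M : nat)
    (mu lambda : {finite_measure set 'rV[R]_d -> \bar R})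
    (Omega B : set 'rV[R]_d)
    (p : 'I_('C(n + d, d)) -> mpoly d R)
    (x : 'I_M -> 'rV[R]_d) (u : 'I_M -> R) :
  (1 <= d)%N ->
  Omega = measure_support mu ->
  poly_integrable n mu ->
  B = measure_support lambda ->
  poly_determining n B ->
  poly_integrable (2 * n) lambda ->
  poly_basis n p ->
  poly_orthonormal lambda B p ->
  ('C(n + d, d) <= M)%N ->
  (forall i, B (x i)) ->
  (forall i, 0 < u i) ->
  quadrature_exact (2 * n) lambda B x u ->
  Omega `<=` B ->
  let V : 'M[R]_(M, 'C(n + d, d)) := \matrix_(i, j) peval (p j) (x i) in
  let D : 'M[R]_M := diag_mx (\row_i u i) in
  let m : 'cV[R]_('C(n + d, d)) :=
    \col_j \int[mu]_(y in Omega) peval (p j) y in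
  let w : 'cV[R]_M := D *m V *m m in
  (bounded_set B ->
     exists2 K : R, is_max_on B (kernel_diag p) K &
       l1norm w <=
         Num.sqrt (fine (lambda B)) * fine (mu Omega) * Num.sqrt K)
  /\
  (forall omega sigma : 'rV[R]_d -> R,
     has_lebesgue_density mu Omega omega ->
     has_lebesgue_density lambda B sigma ->
     (lebesgue_row R d).-integrable Omega (sqr_quotient omega sigma) ->
     l1norm w <=
       Num.sqrt (fine (lambda B)) *
       Num.sqrt (fine (lebesgue_L1norm Omega (sqr_quotient omega sigma)))).
Proof.
move=> _ OmegaE muint BE Bdet laint [pn _ _] orth _ xB u0 xexact OB V D m w.
have mO : measurable Omega by rewrite OmegaE; exact: measurable_measure_support.
have mB : measurable B by rewrite BE; exact: measurable_measure_support.
pose q : mpoly d R := \sum_j m j ord0 *: p j.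
have qn : poly_le n q by exact: poly_le_lincomb.
pose S := \sum_j m j ord0 ^+ 2.
have S0 : 0 <= S by apply: sumr_ge0 => j _; exact: sqr_ge0.
have sqrE : \int[lambda]_(y in B) (peval q y ^+ 2) = S.
  exact: Rintegral_sqr_orthonormal xexact _ _ _ orth.
have wS : l1norm w <= Num.sqrt (fine (lambda B)) * Num.sqrt S.
  rewrite -sqrE; apply: le_trans (quadrature_l1_le mB u0 xexact qn).
  rewrite /l1norm; apply: ler_sum => i _.
  rewrite /w -mulmxA mul_diag_mx !mxE normrM gtr0_norm // peval_lincomb.
  rewrite ler_wpM2l //; first exact: ltW.
  by under eq_bigr do rewrite mxE mulrC.
have qint : mu.-integrable Omega (EFin \o peval q).
  by apply: integrableS (muint _ qn).
have SE : S = \int[mu]_(y in Omega) peval q y.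
  rewrite (Rintegral_peval_lincomb _ mO muint pn); apply: eq_bigr => j _.
  by rewrite expr2 [in RHS]/m; congr (_ * _); rewrite mxE.
have Sabs : S <= \int[mu]_(y in Omega) `|peval q y|.
  by rewrite SE (le_trans (ler_norm _)) // le_normr_Rintegral.
split=> [bB|omega sigma dw ds iq].
  (* On an empty [B] the constant 1 would vanish trivially, and the determining property would give
     1 = 0. *)
  have [y0 By0] : B !=set0.
    apply/set0P/negP => /eqP B0.
    have : peval (1 : mpoly d R) 0 = 0.
      apply: Bdet; last by move=> y; rewrite B0.
      exact: poly_le1.
    by rewrite peval1; apply/eqP; exact: oner_neq0.
  (* Supports are closed, so a bounded one is compact and the continuous kernel attains its maximum
     on it. *)
  have cB : compact B.
    by apply: bounded_closed_compact => //; rewrite BE; exact: closed_measure_support.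
  have [c /[!inE] Bc maxc] : exists2 c, c \in B &
      forall y, y \in B -> kernel_diag p y <= kernel_diag p c.
    apply: EVT_max_rV => //; first by exists y0.
    apply: continuous_subspaceT.
    apply: (@continuous_big R^o) => [|j _ y]; first exact: add_continuous.
    apply: (@continuous_comp _ _ _ (peval (p j)) (fun t => t ^+ 2)).
      exact: continuous_peval.
    exact: exprn_continuous.
  exists (kernel_diag p c).
    by split=> [|y By]; [exists c|apply: maxc; rewrite inE].
  apply: le_trans wS _; rewrite -mulrA ler_wpM2l ?sqrtr_ge0 //.
  set K := kernel_diag p c.
  (* The pointwise kernel bound is integrated over [Omega], where the maximum over [B] applies
     because [Omega] lies in [B]. *)
  have SK : S <= Num.sqrt S * Num.sqrt K * fine (mu Omega).
    apply: le_trans Sabs _; rewrite -Rintegral_cst //.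
    apply: le_Rintegral => //.
    - by have := integrable_norm qint.
    - exact: finite_measure_integrable_cst.
    - move=> y /OB By; apply: le_trans (peval_le_kernel _ _ _) _.
      by rewrite ler_wpM2l ?sqrtr_ge0 // ler_wsqrtr // maxc // inE.
  (* The estimate [SK] is to be divided by [Num.sqrt S], so the trivial case of zero [S] is treated
     apart. *)
  have [S00|Sneq0] := eqVneq S 0.
    by rewrite S00 sqrtr0 mulr_ge0 ?sqrtr_ge0 // fine_ge0.
  have sS : 0 < Num.sqrt S by rewrite sqrtr_gt0 lt_neqAle eq_sym Sneq0.
  rewrite -(ler_pM2l sS) -expr2 sqr_sqrtr //.
  by rewrite [_ * Num.sqrt K]mulrC mulrA.
apply: le_trans wS _; rewrite ler_wpM2l ?sqrtr_ge0 // ler_wsqrtr //.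
have mq : measurable_fun setT (peval q).
  by apply/measurable_EFinP; exact: measurable_int (muint _ qn).
have := integral_density_le mO mB OB mq dw ds (measurable_int _ iq).
(* The square of [q] has degree at most [2 * n], hence is [lambda]-integrable, and its extended-real
   integral is the finite number [S]. *)
have -> : (\int[lambda]_(y in B) (peval q y ^+ 2)%:E = S%:E)%E.
  rewrite -sqrE fineK // integrable_fin_num //.
  have /laint : poly_le (2 * n) (q * q) by rewrite mul2n -addnn; exact: poly_leM.
  move=> /(integrableS measurableT mB (@subsetT _ _)); apply: eq_integrable => // y _.
  by rewrite /= pevalM expr2.
have -> : (\int[mu]_(y in Omega) `|peval q y|%:E =
    (\int[mu]_(y in Omega) `|peval q y|)%:E)%E.
  rewrite fineK // integrable_fin_num //; exact: integrable_norm qint.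
have Lfin : lebesgue_L1norm Omega (sqr_quotient omega sigma) \is a fin_num.
  by apply: integrable_fin_num => //; exact: integrable_abse.
(* With [L] the norm of the quotient, [h] bounds twice the integral of [|q|] by [S + L]. By [Sabs]
   that integral is at least [S], so [S <= L]. *)
rewrite -(fineK Lfin) -!EFinD lee_fin => h; lra.
Qed.
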